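(* A policy $\pi\in\Pi$ is deterministic up to equivalence (i.e. there is a deterministic policy $\pi'$ with $\pi'\sim\pi$) if and only if $x_\pi$ is a vertex of $P$. A state-action frequency vector $x\in P$ is a vertex of $P$ if and only if the regular policy $\pi^x$ is deterministic.
   Context: Model (vMDP). Integers $T\geq 2$, $S\ge 1$; states $\mathbb S=\{1,\dots,S\}$; action sets $\mathbb A_s=\{1,\dots,k_s\}$ with $k_s\ge1$ and $k_s>1$ for at least one $s$; transition probabilities $p_t(j|s,a)$ for $t=1,\dots,T-1$, $s,j\in\mathbb S$, $a\in\mathbb A_s$ (nonnegative, summing to 1 over $j$); initial probabilities $\alpha(s)>0$ with $\sum_{s}\alpha(s)=1$. A policy is $\pi=(\pi_1,\dots,\pi_{T-1})$, where each decision rule $\pi_t$ assigns to each state $s$ a probability distribution $q(\cdot\,|\,s,\pi_t)$ on $\mathbb A_s$; it is deterministic if for all $t,s$ there is $a$ with $q(a|s,\pi_t)=1$. $\Pi$ is the set of all policies. Each $\pi$ induces a probability measure $\mathbb P^\pi$ on trajectories $(\mathbf S_1,\mathbf A_1,\dots,\mathbf S_{T-1},\mathbf A_{T-1},\mathbf S_T)$: $\mathbf S_1$ has law $\alpha$; given the past and $\mathbf S_t=s$, $\mathbf A_t=a$ with probability $q(a|s,\pi_t)$; given the past, $\mathbf S_t=s$ and $\mathbf A_t=a$, $\mathbf S_{t+1}=j$ with probability $p_t(j|s,a)$. Regular policies and equivalence. A state $s$ is unreachable at epoch $t$ under $\pi$ if $\mathbb P^\pi(\mathbf S_t=s|\mathbf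 S_1=j)=0$ for all $j\in\mathbb S$. A policy is regular if $q(1|s,\pi_t)=1$ for all $t=1,\dots,T-1$ and all $s$ unreachable at $t$ under $\pi$. The regularization of $\pi$ is the regular policy obtained by resetting $q(1|s,\pi_t)=1$ at every unreachable $(s,t)$, $t\le T-1$. Write $\pi\sim\pi'$ if $\pi$ and $\pi'$ have the same regularization. State-action frequencies. For $\pi\in\Pi$, $x_\pi$ has components $x_{\pi,t}(s,a)=\sum_{j}\alpha(j)\mathbb P^\pi(\mathbf S_t=s,\mathbf A_t=a|\mathbf S_1=j)$ for $t=1,\dots,T-1$, and $x_{\pi,T}(s)=\sum_j\alpha(j)\mathbb P^\pi(\mathbf S_T=s|\mathbf S_1=j)$. $P$, the set of state-action frequency vectors, is the polyhedron of all $x\geqq0$ (componentwise) with components $x_t(s,a)$ ($t\le T-1$, $s\in\mathbb S$, $a\in\mathbb A_s$) and $x_T(s)$ satisfying (a) $\sum_{a\in\mathbb A_j}x_1(j,a)=\alpha(j)$ for all $j$; (b) $\sum_{a\in\mathbb A_j}x_{t+1}(j,a)=\sum_{s}\sum_{a\in\mathbb A_s}p_t(j|s,a)x_t(s,a)$ for all $j$ and $t=1,\dots,T-2$; (c) $x_T(j)=\sum_{s}\sum_{a\in\mathbb A_s}p_{T-1}(j|s,a)x_{T-1}(s,a)$ for all $j$. For $x\in P$, $\pi^x$ is the regular policy with $q(a|s,\pi^x_t)=x_t(s,a)/\sum_{a'\in\mathbb A_s}x_t(s,a')$ if the denominator is positive, and $q(1|s,\pi^x_t)=1$ otherwise. 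*)

(* Defs.v *)
(* Finite-horizon vector Markov decision processes, epochs, states and actions *)
(* being numbered from 0: epoch t in 1, ..., T is the index t-1, and the       *)
(* distinguished action 1 of each state is the ordinal 0.                      *)
From mathcomp Require Import all_boot all_order all_algebra.

Set Implicit Arguments.
Unset Strict Implicit.
Unset Printing Implicit Defensive.

Import Order.TTheory GRing.Theory Num.Theory.
Local Open Scope ring_scope.

(* trans t a j is p_t(j | s, a); the decision epochs 1, ..., T-1 are the      *)
(* elements of 'I_T.-1. Rewards play no role for policies and frequencies.    *)
Record vmdp (R : realFieldType) := VMDP {
  horizon : nat;
  nstates : nat;
  nactions : 'I_nstates -> nat;
  trans : 'I_horizon.-1 -> forall s : 'I_nstates,
            'I_(nactions s) -> 'I_nstates -> R;
  init : 'I_nstates -> R;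
  horizon_ge2 : (2 <= horizon)%N;
  nstates_ge1 : (1 <= nstates)%N;
  nactions_ge1 : forall s, (1 <= nactions s)%N;
  nactions_gt1 : exists s, (1 < nactions s)%N;
  trans_ge0 : forall t s (a : 'I_(nactions s)) j, 0 <= trans t a j;
  trans_sum1 : forall t s (a : 'I_(nactions s)), \sum_j trans t a j = 1;
  init_gt0 : forall s, 0 < init s;
  init_sum1 : \sum_s init s = 1
}.

Notation epoch M := 'I_(horizon M).-1.
Notation state M := 'I_(nstates M).
Notation action M s := 'I_(@nactions _ M s).

Definition sa (R : realFieldType) (M : vmdp R) : finType :=
  {s : state M & action M s}.

Definition mksa (R : realFieldType) (M : vmdp R) (s : state M)
  (a : action M s) : sa M := Tagged (fun s => action M s) a.

Definition action1 (R : realFieldType) (M : vmdp R) (s : state M) :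
  action M s := Ordinal (nactions_ge1 s).

(* The axiom is boolean, hence proof-irrelevant, so equality of policies is   *)
(* equality of all the probabilities q(a | s, pi_t).                          *)
Record policy (R : realFieldType) (M : vmdp R) := Policy {
  policy_val :> {ffun epoch M * sa M -> R};
  policyP : [forall t, forall s : state M,
    [forall a : action M s, 0 <= policy_val (t, mksa a)]
    && (\sum_(a : action M s) policy_val (t, mksa a) == 1)]
}.

(* q(a | s, pi_t) *)
Definition q (R : realFieldType) (M : vmdp R) (pi : policy M) (t : epoch M)
  (s : state M) (a : action M s) : R := pi (t, mksa a).

Definition deterministic (R : realFieldType) (M : vmdp R) (pi : policy M) :
  Prop := forall t (s : state M), exists a : action M s, q pi t a = 1.

(* A trajectory (S_1, A_1, ..., S_{T-1}, A_{T-1}, S_T) with A_t in A_{S_t}.   *)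
Definition trajectory (R : realFieldType) (M : vmdp R) : finType :=
  ({ffun epoch M -> sa M} * state M)%type.

(* State at the epoch of index i; an i outside 'I_T.-1 means the last epoch.  *)
Definition state_at (R : realFieldType) (M : vmdp R) (w : trajectory M)
  (i : nat) : state M :=
  if insub i is Some t then tag (w.1 t) else w.2.

(* Probability mass of a trajectory under P^pi: the product, by the chain     *)
(* rule, of the conditional probabilities that define P^pi.                   *)
Definition traj_prob (R : realFieldType) (M : vmdp R) (pi : policy M)
  (w : trajectory M) : R :=
  init (state_at w 0) *
  \prod_(t : epoch M)
    (q pi t (tagged (w.1 t)) * trans t (tagged (w.1 t)) (state_at w t.+1)).

Definition Pr (R : realFieldType) (M : vmdp R) (pi : policy M)
  (E : pred (trajectory M)) : R := \sum_(w | E w) traj_prob pi w.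

Definition condPr (R : realFieldType) (M : vmdp R) (pi : policy M)
  (E F : pred (trajectory M)) : R := Pr pi [predI E & F] / Pr pi F.

Definition unreachable (R : realFieldType) (M : vmdp R) (pi : policy M)
  (t : epoch M) (s : state M) : bool :=
  [forall j : state M,
     condPr pi [pred w | state_at w t == s] [pred w | state_at w 0 == j] == 0].

Definition regularize_val (R : realFieldType) (M : vmdp R) (pi : policy M) :
  {ffun epoch M * sa M -> R} :=
  [ffun u => if unreachable pi u.1 (tag u.2)
             then (tagged u.2 == action1 (tag u.2))%:R else pi u].

Lemma regularizeP (R : realFieldType) (M : vmdp R) (pi : policy M) :
  [forall t, forall s : state M,
    [forall a : action M s, 0 <= regularize_val pi (t, mksa a)]
    && (\sum_(a : action M s) regularize_val pi (t, mksa a) == 1)].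
Proof.
apply/forallP => t; apply/forallP => s.
have /forallP /(_ t) /forallP /(_ s) /andP[/forallP q0 q1] := policyP pi.
have E a : regularize_val pi (t, mksa a) =
   if unreachable pi t s then (a == action1 s)%:R else pi (t, mksa a).
  by rewrite ffunE.
apply/andP; split.
  by apply/forallP => a; rewrite E; case: ifP => // _; rewrite ler0n.
rewrite (eq_bigr _ (fun a _ => E a)).
have [_|_] := boolP (unreachable pi t s); last exact: q1.
rewrite (bigD1 (action1 s)) // eqxx big1 => [|a /negPf -> //]; exact/eqP/addr0.
Qed.

Definition regularize (R : realFieldType) (M : vmdp R) (pi : policy M) :
  policy M := Policy (regularizeP pi).

Definition equivalent (R : realFieldType) (M : vmdp R) (pi pi' : policy M) :
  Prop := regularize pi = regularize pi'.

(* Components of a frequency vector: x_t(s, a) at inl (t, (s, a)) and x_T(s)  *)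
(* at inr s. Values are in R^o so that the vectors form a left R-module.      *)
Definition freq (R : realFieldType) (M : vmdp R) :=
  {ffun (epoch M * sa M) + state M -> R^o}.

Definition xsa (R : realFieldType) (M : vmdp R) (x : freq M) (t : epoch M)
  (s : state M) (a : action M s) : R := x (inl (t, mksa a)).

Definition xfin (R : realFieldType) (M : vmdp R) (x : freq M) (s : state M) :
  R := x (inr s).

Definition freq_of (R : realFieldType) (M : vmdp R) (pi : policy M) : freq M :=
  [ffun i : (epoch M * sa M) + state M =>
     \sum_(j : state M) init j *
       condPr pi
         (match i with
          | inl u => [pred w : trajectory M | w.1 u.1 == u.2]
          | inr s => [pred w : trajectory M | w.2 == s]
          end)
         [pred w | state_at w 0 == j]].

Record freq_polyhedron (R : realFieldType) (M : vmdp R) (x : freq M) : Prop :=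
  FreqPolyhedron {
  freq_ge0 : forall i, 0 <= x i;
  freq_init : forall (t : epoch M) (j : state M), t = 0%N :> nat ->
    \sum_(a : action M j) xsa x t a = init j;
  freq_flow : forall (t t' : epoch M) (j : state M), t' = t.+1 :> nat ->
    \sum_(a : action M j) xsa x t' a =
    \sum_(s : state M) \sum_(a : action M s) trans t a j * xsa x t a;
  freq_last : forall (t : epoch M) (j : state M), t.+1 = (horizon M).-1 ->
    xfin x j = \sum_(s : state M) \sum_(a : action M s) trans t a j * xsa x t a
}.

(* Vertex of a convex set: a point of C in the relative interior of no        *)
(* nondegenerate segment of C.                                                *)
Definition vertex (R : realFieldType) (V : lmodType R) (C : V -> Prop)
  (x : V) : Prop :=
  C x /\
  forall (y z : V) (l : R), C y -> C z -> 0 < l < 1 ->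
    x = l *: y + (1 - l) *: z -> y = z.

Definition policy_of_val (R : realFieldType) (M : vmdp R) (x : freq M) :
  {ffun epoch M * sa M -> R} :=
  [ffun u =>
     let d := \sum_(a : action M (tag u.2)) xsa x u.1 a in
     if 0 < d then xsa x u.1 (tagged u.2) / d
     else (tagged u.2 == action1 (tag u.2))%:R].

Lemma policy_ofP (R : realFieldType) (M : vmdp R) (x : freq M)
  (Px : freq_polyhedron x) :
  [forall t, forall s : state M,
    [forall a : action M s, 0 <= policy_of_val x (t, mksa a)]
    && (\sum_(a : action M s) policy_of_val x (t, mksa a) == 1)].
Proof.
apply/forallP => t; apply/forallP => s.
have x0 (a : action M s) : 0 <= xsa x t a := freq_ge0 Px _.
pose d := \sum_(a : action M s) xsa x t a.
have E a : policy_of_val x (t, mksa a) =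
   if 0 < d then xsa x t a / d else (a == action1 s)%:R.
  by rewrite ffunE.
apply/andP; split.
  apply/forallP => a; rewrite E; case: ifP => [d0|_]; last by rewrite ler0n.
  by rewrite divr_ge0 // ltW.
rewrite (eq_bigr _ (fun a _ => E a)).
have [d0|_] := boolP (0 < d); first by rewrite -mulr_suml divff // gt_eqF.
rewrite (bigD1 (action1 s)) // eqxx big1 => [|a /negPf -> //]; exact/eqP/addr0.
Qed.

Definition policy_of (R : realFieldType) (M : vmdp R) (x : freq M)
  (Px : freq_polyhedron x) : policy M := Policy (policy_ofP Px).

(* Main.v *)
Require Import Defs.
From mathcomp Require Import all_boot all_order all_algebra.
From mathcomp Require Import ring lra.

(** Frequency vectors and policies determine each other, as far as they can:
    the flow equations give the state marginals of a vector of the polyhedron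
    [P] epoch by epoch, once it is known how each marginal is split among the
    actions. So a vector of [P] is determined by any policy that it [follows]
    ([follows_unique]). Two consequences identify regular policies with points
    of [P]: [x] is the frequency vector of [policy_of x]
    ([freq_of_policy_of]), and [policy_of (freq_of pi)] is the regularization
    of [pi] ([policy_of_freq_of]), since a state is unreachable exactly when
    its marginal vanishes. Hence both halves of the theorem reduce to the
    second one, [vertexP].

    If the policy of [x] is deterministic and [x] lies inside a segment of [P],
    the ends of the segment vanish wherever [x] does, so they follow the same
    deterministic rule as [x] and coincide ([deterministic_vertex]).
    Conversely, suppose that at one epoch and state of positive marginal the
    policy plays an action [a] with probability [l] strictly between 0 and 1.
    The probability of a trajectory is an affine function of the decision rule
    of one epoch, the others being fixed ([traj_prob_affine]); writing the rule
    as a mixture, with weights [l] and [1 - l], of always and of never playing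
    [a] puts [x] inside a segment of [P] whose ends differ in the coordinate of
    [a] ([vertex_deterministic]).

    What links probabilities to frequencies is that trajectories form a Markov
    chain. The marginals needed, [chain_sum_init], [chain_action] and
    [chain_next], are obtained by induction on the number of epochs, by
    conditioning on the first state-action pair ([chain_sum_first]); the
    initial law has to vary in that induction, because the remaining chain
    starts from a row of the first transition kernel. *)

Set Implicit Arguments.
Unset Strict Implicit.
Unset Printing Implicit Defensive.

Import Order.TTheory GRing.Theory Num.Theory.
Local Open Scope ring_scope.

(** * Marginals of a finite Markov decision chain *)

Section Chain.
Variables (R : realFieldType) (S X : finType) (st : X -> S).

Definition chain_state n (w : {ffun 'I_n -> X} * S) (i : nat) : S :=
  if insub i is Some t then st (w.1 t) else w.2.

Definition chain_mass n (mu : S -> R) (q : 'I_n -> X -> R)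
    (p : 'I_n -> X -> S -> R) (w : {ffun 'I_n -> X} * S) : R :=
  mu (chain_state w 0) *
  \prod_(t < n) (q t (w.1 t) * p t (w.1 t) (chain_state w t.+1)).

Definition chain_cons n (u : X * ({ffun 'I_n -> X} * S)) :
    {ffun 'I_n.+1 -> X} * S :=
  ([ffun i => if unlift ord0 i is Some j then u.2.1 j else u.1], u.2.2).

Definition chain_uncons n (w : {ffun 'I_n.+1 -> X} * S) :
    X * ({ffun 'I_n -> X} * S) :=
  (w.1 ord0, ([ffun j => w.1 (lift ord0 j)], w.2)).

Lemma chain_consK n : cancel (@chain_cons n) (@chain_uncons n).
Proof.
case=> x [f s]; rewrite /chain_uncons /chain_cons /= ffunE unlift_none.
by congr (_, (_, _)); apply/ffunP => j; rewrite !ffunE liftK.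
Qed.

Lemma chain_unconsK n : cancel (@chain_uncons n) (@chain_cons n).
Proof.
case=> f s; congr (_, _); apply/ffunP => i; rewrite ffunE /=.
by case: unliftP => [j ->|-> //]; rewrite ffunE.
Qed.

Lemma chain_cons0 n x (w : {ffun 'I_n -> X} * S) :
  (chain_cons (x, w)).1 ord0 = x.
Proof. by rewrite ffunE unlift_none. Qed.

Lemma chain_consS n x (w : {ffun 'I_n -> X} * S) t :
  (chain_cons (x, w)).1 (lift ord0 t) = w.1 t.
Proof. by rewrite ffunE liftK. Qed.

Lemma chain_state_ord n (w : {ffun 'I_n -> X} * S) (t : 'I_n) :
  chain_state w t = st (w.1 t).
Proof. by rewrite /chain_state valK. Qed.

Lemma chain_state_last n (w : {ffun 'I_n -> X} * S) : chain_state w n = w.2.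
Proof. by rewrite /chain_state insubN // ltnn. Qed.

Lemma chain_state_cons0 n x (w : {ffun 'I_n -> X} * S) :
  chain_state (chain_cons (x, w)) 0 = st x.
Proof. by rewrite -[0%N]/(val (@ord0 n)) chain_state_ord chain_cons0. Qed.

Lemma chain_state_consS n x (w : {ffun 'I_n -> X} * S) i :
  chain_state (chain_cons (x, w)) i.+1 = chain_state w i.
Proof.
rewrite /chain_state; case: insubP => [t it ti|ni]; case: insubP => [t' it' ti'|ni'].
- have -> : t = lift ord0 t' by apply: val_inj; rewrite /= ti -ti'.
  by rewrite chain_consS.
- by rewrite ltnS in it; rewrite it in ni'.
- by rewrite ltnS it' in ni.
- by [].
Qed.

(** Conditioning on the first state-action pair: given [x], what remains is a
    chain with one epoch less, started from the law [p ord0 x]. *)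
Lemma chain_sum_first n mu q p (F : {ffun 'I_n.+1 -> X} * S -> R) :
  \sum_w chain_mass mu q p w * F w =
  \sum_x mu (st x) * q ord0 x *
    \sum_w chain_mass (p ord0 x) (fun t => q (lift ord0 t))
             (fun t => p (lift ord0 t)) w * F (chain_cons (x, w)).
Proof.
rewrite (reindex (@chain_cons n)); last first.
  by exists (@chain_uncons n) => ? _; rewrite ?chain_consK ?chain_unconsK.
under [RHS]eq_bigr do rewrite mulr_sumr.
rewrite pair_bigA; apply: eq_bigr => -[x w] _ /=.
rewrite /chain_mass chain_state_cons0 big_ord_recl chain_cons0.
rewrite (chain_state_consS x w 0).
under eq_bigr => t _ do rewrite chain_consS (chain_state_consS x w t.+1).
by rewrite /=; ring.
Qed.

Definition chain_kernels n (q : 'I_n -> X -> R) (p : 'I_n -> X -> S -> R) :=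
  (forall t s, \sum_(x | st x == s) q t x = 1) /\
  (forall t x, \sum_s p t x s = 1).

Lemma chain_kernelsS n (q : 'I_n.+1 -> X -> R) p :
  chain_kernels q p ->
  chain_kernels (fun t => q (lift ord0 t)) (fun t => p (lift ord0 t)).
Proof. by case=> hq hp; split=> t; [exact: hq | exact: hp]. Qed.

(** A function of the first state only integrates against the initial law. *)
Lemma chain_sum_init n mu (q : 'I_n -> X -> R) p (g : S -> R) :
  chain_kernels q p ->
  \sum_w chain_mass mu q p w * g (chain_state w 0) = \sum_s mu s * g s.
Proof.
elim: n mu q p g => [|n IHn] mu q p g hqp.
  rewrite -(pair_bigA _ (fun f s => chain_mass mu q p (f, s) *
     g (chain_state (f, s) 0))) /= (big_pred1 [ffun i => ffun0 (card_ord 0) i]).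
    apply: eq_bigr => s _; rewrite /chain_mass big_ord0 mulr1.
    by rewrite !chain_state_last.
  by move=> f; symmetry; apply/eqP/ffunP => -[].
rewrite chain_sum_first [LHS](partition_big st xpredT) //=.
apply: eq_bigr => s _; rewrite -[RHS]mulr1 -(hqp.1 ord0 s) mulr_sumr.
apply: eq_bigr => x /eqP <-.
under eq_bigr do rewrite chain_state_cons0.
have := IHn (p ord0 x) _ _ (fun=> g (st x)) (chain_kernelsS hqp) => /= ->.
by rewrite -mulr_suml hqp.2; ring.
Qed.

(** Induction on the length moves the epoch [t] to the start of the chain,
    where both sides are [mu (st x) * q ord0 x]. *)
Lemma chain_action n mu (q : 'I_n -> X -> R) p t x :
  chain_kernels q p ->
  \sum_w chain_mass mu q p w * (w.1 t == x)%:R =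
  (\sum_w chain_mass mu q p w * (chain_state w t == st x)%:R) * q t x.
Proof.
elim: n mu q p t => [|n IHn] mu q p t hqp; first by case: t.
case: (unliftP ord0 t) => [i|] ->{t}; rewrite !chain_sum_first.
  rewrite mulr_suml; apply: eq_bigr => y _.
  under eq_bigr do rewrite chain_consS.
  rewrite IHn; last exact: chain_kernelsS.
  by under [in RHS]eq_bigr do rewrite chain_state_consS; rewrite mulrA.
(* The chain that remains after the first pair has total mass 1. *)
have tot y c : \sum_w chain_mass (p ord0 y) (fun t => q (lift ord0 t))
             (fun t => p (lift ord0 t)) w * c = c.
  rewrite (chain_sum_init _ (fun=> c)); last exact: chain_kernelsS.
  by rewrite -mulr_suml hqp.2 mul1r.
under eq_bigr => y _ do
  (under eq_bigr do rewrite chain_cons0; rewrite tot).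
under [in RHS]eq_bigr => y _ do
  (under eq_bigr do rewrite chain_state_cons0; rewrite tot).
rewrite (bigD1 x) //= eqxx big1 => [|y /negPf ->]; last by rewrite mulr0.
under [in RHS]eq_bigr do rewrite mulr_natr mulrb.
rewrite -big_mkcond (eq_bigr (fun y => mu (st x) * q ord0 y)).
  by rewrite -mulr_sumr hqp.1 !mulr1 addr0.
by move=> y /eqP ->.
Qed.

(** At the start of the chain this is [chain_sum_init] for the chain that
    remains after the first pair, whose initial law is [p ord0 x]. *)
Lemma chain_next n mu (q : 'I_n -> X -> R) p t x j :
  chain_kernels q p ->
  \sum_w chain_mass mu q p w * ((w.1 t == x) && (chain_state w t.+1 == j))%:R =
  p t x j * \sum_w chain_mass mu q p w * (w.1 t == x)%:R.
Proof.
elim: n mu q p t => [|n IHn] mu q p t hqp; first by case: t.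
case: (unliftP ord0 t) => [i|] ->{t}; rewrite !chain_sum_first.
  rewrite mulr_sumr; apply: eq_bigr => y _.
  under eq_bigr do rewrite chain_consS chain_state_consS.
  rewrite IHn; last exact: chain_kernelsS.
  by under [in RHS]eq_bigr do rewrite chain_consS; ring.
have init y g := chain_sum_init (p ord0 y) g (chain_kernelsS hqp).
rewrite mulr_sumr; apply: eq_bigr => y _.
under eq_bigr do rewrite chain_cons0 chain_state_consS.
under [in RHS]eq_bigr do rewrite chain_cons0.
rewrite (init y (fun s => ((y == x) && (s == j))%:R)).
rewrite (init y (fun=> (y == x)%:R)) -mulr_suml hqp.2.
have [->|_] := eqVneq y x; last first.
  by rewrite big1 => [|s _]; rewrite /= ?mulr0 ?mulr0.
rewrite (bigD1 j) //= eqxx big1 => [|s /negPf ->]; last by rewrite mulr0.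
by rewrite !mulr1 addr0; ring.
Qed.

End Chain.

(** * State-action frequencies as unconditional probabilities *)

Section Frequencies.
Variables (R : realFieldType) (M : vmdp R).
Implicit Types (pi : policy M) (x : freq M) (t : epoch M) (s j : state M).

Lemma sum_sa (F : sa M -> R) s :
  \sum_(u | tag u == s) F u = \sum_(a : action M s) F (mksa a).
Proof.
have -> : \sum_(u | tag u == s) F u =
    \sum_s' \sum_(a : action M s') (if s' == s then F (mksa a) else 0).
  rewrite big_mkcond (sig_big_dep (fun _ => true) (fun _ _ => true)
    (fun s' (a : action M s') => if s' == s then F (mksa a) else 0)) /=.
  by apply: eq_bigr => -[].
rewrite (bigD1 s) //= eqxx [X in _ + X]big1 ?addr0 // => s' /negPf ->.
by rewrite big1.
Qed.

Lemma sum_sa_all (F : sa M -> R) :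
  \sum_s \sum_(a : action M s) F (mksa a) = \sum_u F u.
Proof.
rewrite (sig_big_dep (fun _ => true) (fun _ _ => true)
    (fun s' (a : action M s') => F (mksa a))) /=.
by apply: eq_bigr => -[].
Qed.

Lemma q_ge0 pi t s (a : action M s) : 0 <= q pi t a.
Proof.
by have /forallP/(_ t)/forallP/(_ s)/andP[/forallP/(_ a)] := policyP pi.
Qed.

Lemma q_sum1 pi t s : \sum_(a : action M s) q pi t a = 1.
Proof.
by have /forallP/(_ t)/forallP/(_ s)/andP[_ /eqP] := policyP pi.
Qed.

Lemma policy_eq pi pi' : policy_val pi = policy_val pi' -> pi = pi'.
Proof.
case: pi pi' => f hf [g hg] /= fg; rewrite {}fg in hf *.
by congr Policy; exact: bool_irrelevance.
Qed.

Lemma traj_kernels pi :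
  chain_kernels (@tag _ _) (fun t (u : sa M) => q pi t (tagged u))
    (fun t (u : sa M) => trans t (tagged u)).
Proof.
split=> [t s|t u]; last exact: trans_sum1.
by rewrite sum_sa q_sum1.
Qed.

Lemma PrE pi (E : pred (trajectory M)) :
  Pr pi E = \sum_w chain_mass (@tag _ _) (@init _ M)
    (fun t (u : sa M) => q pi t (tagged u))
    (fun t (u : sa M) => trans t (tagged u)) w * (E w)%:R.
Proof.
rewrite /Pr big_mkcond; apply: eq_bigr => w _ /=.
by rewrite mulr_natr mulrb.
Qed.

Lemma traj_prob_ge0 pi w : 0 <= traj_prob pi w.
Proof.
apply: mulr_ge0; first exact/ltW/init_gt0.
by apply: prodr_ge0 => t _; rewrite mulr_ge0 ?q_ge0 ?trans_ge0.
Qed.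

Lemma Pr_ge0 pi E : 0 <= Pr pi E.
Proof. by apply: sumr_ge0 => w _; exact: traj_prob_ge0. Qed.

Lemma Pr_init pi j : Pr pi [pred w : trajectory M | state_at w 0 == j] = init j.
Proof.
rewrite PrE (chain_sum_init _ (fun s => (s == j)%:R) (traj_kernels pi)).
rewrite (bigD1 j) //= eqxx mulr1 big1 ?addr0 // => s /negPf ->.
by rewrite mulr0.
Qed.

Lemma Pr_partition pi (E : pred (trajectory M)) (I : finType)
    (f : trajectory M -> I) :
  Pr pi E = \sum_i Pr pi [predI E & [pred w : trajectory M | f w == i]].
Proof. by rewrite /Pr (partition_big f xpredT). Qed.

Lemma Pr_action pi t s (a : action M s) :
  Pr pi [pred w : trajectory M | w.1 t == mksa a] =
  Pr pi [pred w : trajectory M | state_at w t == s] * q pi t a.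
Proof. by rewrite !PrE (chain_action _ _ _ (traj_kernels pi)). Qed.

Lemma Pr_state pi t s :
  Pr pi [pred w : trajectory M | state_at w t == s] =
  \sum_(a : action M s) Pr pi [pred w : trajectory M | w.1 t == mksa a].
Proof.
by under eq_bigr do rewrite Pr_action; rewrite -mulr_sumr q_sum1 mulr1.
Qed.

Lemma Pr_next pi t j :
  Pr pi [pred w : trajectory M | state_at w t.+1 == j] =
  \sum_s \sum_(a : action M s)
     trans t a j * Pr pi [pred w : trajectory M | w.1 t == mksa a].
Proof.
rewrite (sum_sa_all (fun u =>
  trans t (tagged u) j * Pr pi [pred w : trajectory M | w.1 t == u])).
rewrite (Pr_partition pi _ (fun w : trajectory M => w.1 t)); apply: eq_bigr => u _.
rewrite !PrE -(chain_next _ _ _ _ (traj_kernels pi)).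
by apply: eq_bigr => w _; rewrite /= andbC.
Qed.

Definition freq_event (i : (epoch M * sa M) + state M) :
    pred (trajectory M) :=
  match i with
  | inl u => [pred w : trajectory M | w.1 u.1 == u.2]
  | inr s => [pred w : trajectory M | w.2 == s]
  end.

(** Since every initial probability is positive, averaging the conditional
    probabilities over the initial state is the law of total probability. *)
Lemma freq_ofE pi i : freq_of pi i = Pr pi (freq_event i).
Proof.
rewrite ffunE (Pr_partition pi _ (fun w => state_at w 0)).
apply: eq_bigr => j _; rewrite /condPr Pr_init mulrC divfK //.
by rewrite gt_eqF ?init_gt0.
Qed.

Lemma freq_sum_action pi t s :
  \sum_(a : action M s) xsa (freq_of pi) t a =
  Pr pi [pred w : trajectory M | state_at w t == s].
Proof. by rewrite Pr_state; apply: eq_bigr => a _; rewrite /xsa freq_ofE. Qed.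

Lemma freq_of_polyhedron pi : freq_polyhedron (freq_of pi).
Proof.
have step t j : \sum_s \sum_(a : action M s) trans t a j * xsa (freq_of pi) t a
    = Pr pi [pred w : trajectory M | state_at w t.+1 == j].
  rewrite Pr_next; apply: eq_bigr => s _; apply: eq_bigr => a _.
  by rewrite /xsa freq_ofE.
split=> [i|t j t0|t t' j tt'|t j tn].
- by rewrite freq_ofE Pr_ge0.
- by rewrite freq_sum_action t0 Pr_init.
- by rewrite freq_sum_action step tt'.
- rewrite step /xfin freq_ofE tn; apply: eq_bigl => w /=.
  by congr (_ == _); rewrite -[LHS](chain_state_last (@tag _ _)).
Qed.

(** The state marginal is the mean of the conditional probabilities with the
    positive weights [init], so it vanishes exactly when all of them do. *)
Lemma unreachableE pi t s :
  unreachable pi t s = (\sum_(a : action M s) xsa (freq_of pi) t a == 0).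
Proof.
rewrite freq_sum_action (Pr_partition pi _ (fun w => state_at w 0)).
rewrite psumr_eq0; last by move=> j _; exact: Pr_ge0.
rewrite -big_all big_andE; apply: eq_forallb => j.
rewrite /condPr Pr_init mulf_eq0 invr_eq0 [init j == 0]gt_eqF ?init_gt0 //.
by rewrite orbF.
Qed.

(** * Frequency vectors driven by a decision rule *)

(** Stated without dividing by the state marginal: where it vanishes, a vector
    of the polyhedron follows whatever the policy plays. *)
Definition follows pi x := forall t s (a : action M s),
  xsa x t a = (\sum_(a' : action M s) xsa x t a') * q pi t a.

Lemma freq_of_follows pi : follows pi (freq_of pi).
Proof.
by move=> t s a; rewrite freq_sum_action -Pr_action /xsa freq_ofE.
Qed.

(** The flow equations determine the state marginals epoch by epoch, and the
    decision rules split each of them among the actions. *)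
Lemma follows_unique pi x y :
  freq_polyhedron x -> freq_polyhedron y -> follows pi x -> follows pi y ->
  x = y.
Proof.
move=> Px Py fx fy.
have marg k t s : t = k :> nat ->
    \sum_(a : action M s) xsa x t a = \sum_(a : action M s) xsa y t a.
  elim: k t s => [|k IHk] t s tk; first by rewrite !freq_init.
  have kT : (k < (horizon M).-1)%N by rewrite -ltnS -tk ltnS ltnW.
  rewrite (freq_flow Px (t := Ordinal kT)) // (freq_flow Py (t := Ordinal kT)) //.
  apply: eq_bigr => s' _; apply: eq_bigr => a _; congr (_ * _).
  by rewrite fx fy IHk.
have eqsa t s (a : action M s) : xsa x t a = xsa y t a.
  by rewrite fx fy (marg t).
have T0 : (0 < (horizon M).-1)%N by case: (horizon M) (horizon_ge2 M) => [|[]].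
have TT : ((horizon M).-2 < (horizon M).-1)%N by case: (horizon M).-1 T0.
apply/ffunP => -[[t [s a]]|s]; first exact: eqsa.
have last z (Pz : freq_polyhedron z) := freq_last (t := Ordinal TT) Pz s (prednK T0).
rewrite -[LHS]/(xfin x s) -[RHS]/(xfin y s) !last //.
by apply: eq_bigr => s' _; apply: eq_bigr => a _; rewrite eqsa.
Qed.

Lemma xsa_ge0 x t s (a : action M s) : freq_polyhedron x -> 0 <= xsa x t a.
Proof. by move=> Px; exact: freq_ge0. Qed.

Lemma xsa_sum0 x t s (a : action M s) : freq_polyhedron x ->
  \sum_(a' : action M s) xsa x t a' = 0 -> xsa x t a = 0.
Proof.
move=> Px /psumr_eq0P -> // a' _; exact: xsa_ge0.
Qed.

Lemma q_policy_of x (Px : freq_polyhedron x) t s (a : action M s) :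
  q (policy_of Px) t a =
  let d := \sum_(a' : action M s) xsa x t a' in
  if 0 < d then xsa x t a / d else (a == action1 s)%:R.
Proof. by rewrite /q ffunE. Qed.

Lemma policy_of_follows x (Px : freq_polyhedron x) : follows (policy_of Px) x.
Proof.
move=> t s a; rewrite q_policy_of /=; case: ltrP => [d0|d0].
  by rewrite mulrC divfK // gt_eqF.
suff d1 : \sum_(a' : action M s) xsa x t a' = 0 by rewrite xsa_sum0 ?d1 ?mul0r.
by apply/eqP; rewrite eq_le d0 sumr_ge0 // => a' _; exact: xsa_ge0.
Qed.

Lemma freq_of_policy_of x (Px : freq_polyhedron x) :
  freq_of (policy_of Px) = x.
Proof.
apply: (follows_unique _ Px (freq_of_follows _) (policy_of_follows Px)).
exact: freq_of_polyhedron.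
Qed.

(** Both sides play [action1] where the state marginal vanishes; elsewhere the
    normalization recovers the conditional probabilities of the actions. *)
Lemma policy_of_freq_of pi (P : freq_polyhedron (freq_of pi)) :
  policy_of P = regularize pi.
Proof.
apply: policy_eq; apply/ffunP => -[t [s a]]; rewrite !ffunE /=.
rewrite unreachableE lt_def sumr_ge0 ?andbT => [|a' _]; last exact: xsa_ge0.
case: eqP => //= /eqP d0.
by rewrite freq_of_follows mulrC mulKf.
Qed.

(** * Deterministic policies and vertices *)

(** An interior point of a segment of nonnegative vectors has a zero coordinate
    only where both ends do, and with a deterministic rule the support alone
    says how to split a marginal. *)
Lemma deterministic_vertex x (Px : freq_polyhedron x) :
  deterministic (policy_of Px) -> vertex (@freq_polyhedron R M) x.
Proof.
move=> det; split=> // y z l Py Pz l01 xE.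
(* Coordinates vanishing at [x] vanish at [y] and [z], so both follow the same
   deterministic rule as [x]. *)
have supp y' z' l' : freq_polyhedron y' -> freq_polyhedron z' -> 0 < l' < 1 ->
    x = l' *: y' + (1 - l') *: z' -> follows (policy_of Px) y'.
  move=> Py' Pz' /andP[l0 l1] xE' t s a.
  have y0 a' : xsa x t a' = 0 -> xsa y' t a' = 0.
    rewrite /xsa xE' !ffunE /= => /eqP; rewrite paddr_eq0; last 2 first.
    - by rewrite mulr_ge0 ?(ltW l0) ?freq_ge0.
    - by rewrite mulr_ge0 ?subr_ge0 ?(ltW l1) ?freq_ge0.
    by rewrite !mulf_eq0 gt_eqF //= => /andP[/eqP].
  have [b qb] := det t s.
  have q0 a' : a' != b -> q (policy_of Px) t a' = 0.
    have := q_sum1 (policy_of Px) t s; rewrite (bigD1 b) //= qb.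
    move=> /(canRL (addKr _)); rewrite addNr => /psumr_eq0P H a'b.
    by apply: H => // i _; exact: q_ge0.
  have y'0 a' : a' != b -> xsa y' t a' = 0.
    by move=> a'b; apply: y0; rewrite (policy_of_follows Px) q0 ?mulr0.
  rewrite (bigD1 b) //= big1 // addr0.
  have [->|ab] := eqVneq a b; first by rewrite qb mulr1.
  by rewrite y'0 ?q0 ?mulr0.
have l01' : 0 < 1 - l < 1 by case/andP: l01 => l0 l1; lra.
apply: (follows_unique Py Pz); first exact: (supp y z l).
by apply: (supp z y (1 - l)) => //; rewrite xE subKr addrC.
Qed.

(** A trajectory passes once through each epoch, so its probability contains
    exactly one factor depending on the decision rule of that epoch. *)
Lemma traj_prob_affine pi pi1 pi2 t0 l :
  (forall t u, t != t0 -> pi1 (t, u) = pi (t, u) /\ pi2 (t, u) = pi (t, u)) ->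
  (forall u, pi (t0, u) = l * pi1 (t0, u) + (1 - l) * pi2 (t0, u)) ->
  forall w, traj_prob pi w = l * traj_prob pi1 w + (1 - l) * traj_prob pi2 w.
Proof.
move=> same aff w; rewrite /traj_prob !(bigD1 t0 (P := xpredT)) //=.
have E pi' : (forall t u, t != t0 -> pi' (t, u) = pi (t, u)) ->
    \prod_(t | t != t0) (q pi' t (tagged (w.1 t)) *
                         trans t (tagged (w.1 t)) (state_at w t.+1)) =
    \prod_(t | t != t0) (q pi t (tagged (w.1 t)) *
                         trans t (tagged (w.1 t)) (state_at w t.+1)).
  by move=> h; apply: eq_bigr => t tt0; rewrite /q h.
rewrite !(E pi1, E pi2); try by move=> t u tt0; case: (same t u tt0).
by rewrite {1}/q aff -/(q pi1 _ _) -/(q pi2 _ _); ring.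
Qed.

Lemma freq_of_affine pi pi1 pi2 t0 l :
  (forall t u, t != t0 -> pi1 (t, u) = pi (t, u) /\ pi2 (t, u) = pi (t, u)) ->
  (forall u, pi (t0, u) = l * pi1 (t0, u) + (1 - l) * pi2 (t0, u)) ->
  freq_of pi = l *: freq_of pi1 + (1 - l) *: freq_of pi2.
Proof.
move=> same aff; apply/ffunP => i; rewrite [LHS]freq_ofE [RHS]ffunE.
rewrite ![(_ *: _ : freq M) i]ffunE !freq_ofE /Pr.
rewrite (eq_bigr _ (fun w _ => traj_prob_affine same aff w)).
by rewrite big_split /= -!mulr_sumr.
Qed.

(** The sum has exactly one term where it is used; it carries [d] along the
    equality [tag u.2 = s0] without transporting dependent types. *)
Definition override_val pi t0 s0 (d : action M s0 -> R) :
    {ffun epoch M * sa M -> R} :=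
  [ffun u => if (u.1 == t0) && (tag u.2 == s0)
             then \sum_(a | mksa a == u.2) d a else pi u].

Lemma override_val_at pi t0 s0 (d : action M s0 -> R) a :
  override_val pi t0 d (t0, mksa a) = d a.
Proof.
rewrite ffunE /= !eqxx /= (big_pred1 a) // => a'.
by rewrite /mksa eq_Tagged.
Qed.

Lemma override_val_off pi t0 s0 (d : action M s0 -> R) t u :
  ~~ ((t == t0) && (tag u == s0)) ->
  override_val pi t0 d (t, u) = pi (t, u).
Proof. by rewrite ffunE /= => /negPf ->. Qed.

Lemma override_valP pi t0 s0 (d : action M s0 -> R) :
  (forall a, 0 <= d a) -> \sum_a d a = 1 ->
  [forall t, forall s : state M,
    [forall a : action M s, 0 <= override_val pi t0 d (t, mksa a)]
    && (\sum_(a : action M s) override_val pi t0 d (t, mksa a) == 1)].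
Proof.
move=> d0 d1; apply/'forall_forallP => t s.
have [/andP[/eqP -> /eqP ->]|off] := boolP ((t == t0) && (s == s0)).
  under eq_bigr do rewrite override_val_at.
  by rewrite d1 eqxx andbT; apply/forallP => a; rewrite override_val_at.
under eq_bigr do rewrite override_val_off //.
rewrite q_sum1 eqxx andbT; apply/forallP => a.
by rewrite override_val_off ?q_ge0.
Qed.

(** Randomization between an action [a] and the others at a single epoch and
    state splits the policy into two, one always playing [a] there and one
    never playing it. *)
Lemma split_policy pi t s (a : action M s) :
  q pi t a < 1 ->
  exists pi1 pi2 : policy M,
    [/\ q pi1 t a = 1, q pi2 t a = 0 &
     freq_of pi =
     q pi t a *: freq_of pi1 + (1 - q pi t a) *: freq_of pi2].
Proof.
move=> lt1; set l := q pi t a in lt1 *.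
have l1 : 0 < 1 - l by rewrite subr_gt0.
pose d1 b : R := (b == a)%:R.
pose d2 b : R := if b == a then 0 else q pi t b / (1 - l).
have d1_ge0 b : 0 <= d1 b by rewrite ler0n.
have d2_ge0 b : 0 <= d2 b.
  by rewrite /d2; case: eqP => // _; rewrite divr_ge0 ?q_ge0 ?ltW.
have d1_sum : \sum_b d1 b = 1.
  by rewrite (bigD1 a) //= /d1 eqxx big1 ?addr0 // => b /negPf ->.
have d2_sum : \sum_b d2 b = 1.
  rewrite (bigD1 a) //= {1}/d2 eqxx add0r.
  rewrite (eq_bigr (fun b => q pi t b / (1 - l))) => [|b /negPf ba]; last first.
    by rewrite /d2 ba.
  rewrite -mulr_suml; have := q_sum1 pi t s; rewrite (bigD1 a) //= -/l.
  by move=> /(canRL (addKr _)); rewrite addrC => ->; rewrite divff ?gt_eqF.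
pose pi1 := Policy (override_valP pi t d1_ge0 d1_sum).
pose pi2 := Policy (override_valP pi t d2_ge0 d2_sum).
exists pi1, pi2; split.
- by rewrite /q /= override_val_at /d1 eqxx.
- by rewrite /q /= override_val_at /d2 eqxx.
apply: (freq_of_affine (t0 := t)) => [t' u tt'|u].
  by rewrite /= !override_val_off // (negPf tt').
have [us|us] := eqVneq (tag u) s; last first.
  by rewrite /= !override_val_off ?(negPf us) ?andbF //; ring.
case: u us => s' b /= ss'; subst s'; rewrite -/(mksa b) !override_val_at.
rewrite /d1 /d2; have [->|_] := eqVneq b a.
  by rewrite mulr1 mulr0 addr0.
by rewrite mulr0 add0r mulrC divfK // gt_eqF.
Qed.

(** A randomized action at a state of positive marginal splits the policy in
    two, and [x] is then strictly between the two frequency vectors. *)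
Lemma vertex_deterministic x (Px : freq_polyhedron x) :
  vertex (@freq_polyhedron R M) x -> deterministic (policy_of Px).
Proof.
case=> _ ext t s; set pi := policy_of Px.
have [d0|d0] := ltrP 0 (\sum_(a : action M s) xsa x t a); last first.
  by exists (action1 s); rewrite q_policy_of /= ltNge d0.
have [a xa] : exists a : action M s, 0 < xsa x t a.
  apply/existsP; apply: contraLR d0; rewrite negb_exists.
  rewrite -leNgt => /forallP h.
  by apply: sumr_le0 => a _; rewrite leNgt.
exists a; apply/eqP; apply: contraT => q1.
have qa0 : 0 < q pi t a by rewrite q_policy_of /= d0 divr_gt0.
have qa1 : q pi t a < 1.
  rewrite lt_neqAle q1 -(q_sum1 pi t s) (bigD1 a) //= lerDl.
  by apply: sumr_ge0 => b _; exact: q_ge0.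
have [pi1 [pi2 [q11 q20 xE]]] := split_policy qa1.
rewrite freq_of_policy_of in xE.
have yz : freq_of pi1 = freq_of pi2.
  by apply: ext xE; rewrite ?qa0 //; exact: freq_of_polyhedron.
(* The frequency of [a] is zero under the second half, hence under both. *)
have z0 : xsa (freq_of pi2) t a = 0 by rewrite freq_of_follows q20 mulr0.
by move: xa; rewrite xE yz -scalerDl addrC subrK scale1r z0 ltxx.
Qed.

Lemma vertexP x (Px : freq_polyhedron x) :
  vertex (@freq_polyhedron R M) x <-> deterministic (policy_of Px).
Proof. by split; [exact: vertex_deterministic | exact: deterministic_vertex]. Qed.

Lemma regularize_deterministic pi :
  deterministic pi -> deterministic (regularize pi).
Proof.
move=> det t s; have [a qa] := det t s.
case un : (unreachable pi t s).
  by exists (action1 s); rewrite /q ffunE /= un.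
by exists a; rewrite /q ffunE /= un.
Qed.

Lemma regularize_idem pi : regularize (regularize pi) = regularize pi.
Proof.
have P := freq_of_polyhedron pi; have P' := freq_of_polyhedron (regularize pi).
rewrite -[LHS](policy_of_freq_of P') -[RHS](policy_of_freq_of P).
apply: policy_eq => /=.
by rewrite -(policy_of_freq_of P) freq_of_policy_of.
Qed.

End Frequencies.

Theorem corollary6p7 (R : realFieldType) (M : vmdp R) :
  (forall pi : policy M,
     (exists pi' : policy M, deterministic pi' /\ equivalent pi' pi) <->
     vertex (@freq_polyhedron R M) (freq_of pi)) /\
  (forall (x : freq M) (Px : freq_polyhedron x),
     vertex (@freq_polyhedron R M) x <-> deterministic (policy_of Px)).
Proof.
split=> [pi|x Px]; last exact: vertexP.
rewrite (vertexP (freq_of_polyhedron pi)) policy_of_freq_of; split.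
  by case=> pi' [det <-]; exact: regularize_deterministic.
by exists (regularize pi); split; last exact: regularize_idem.
Qed.
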